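(* Let $\Sigma,\Gamma$ be finite alphabets and $\pi:\Sigma_\square\times m\to\Gamma$ a well-defined strict interpretation in normal form, with blank enrichment $\pi_b:\Sigma_\square\times m\to\Gamma_\square$. Then for every string $s\in\Gamma_\square^\star$, $d([\![\pi_b]\!](s))=d([\![\pi]\!](d(s)))$.
   Context: Strings as structures: a string $s$ over an alphabet is identified with the structure with domain $\{0,\dots,|s|-1\}$, unary predicates for each character true at indices carrying it, $\min$ (true only at $0$), $\max$ (true only at $|s|-1$), and functions $\mathrm{S}$ ($x\mapsto x+1$, fixing $|s|-1$), $\mathrm{P}$ ($x\mapsto x-1$, fixing $0$). BMRS: terms over a single variable $\mathtt{x}$: index terms $\mathtt{x},\mathrm{S}(T),\mathrm{P}(T)$ and index if-then-else; boolean terms $\mathtt{tt},\mathtt{ff},\mathtt{f}(T)$ ($\mathtt{f}$ a recursive name), $\gamma(T)$, $\max(T)$, $\min(T)$ and boolean if-then-else. A headless BMRS is a finite set of definitions $\mathtt{f}_i(\mathtt{x})=T_i$ with boolean bodies; evaluation $s,x\vdash T\to v$ is the standard least big-step relation (primitives interpreted in $s$; $\mathtt{f}_i(T)$ evaluates $T$ to $v$, then $T_i$ at $v$; if-then-else evaluates guard then branch). A BMRS is a headless BMRS plus finitely many terms called heads. An interpretation $\pi:\Sigma\times m\to\Gamma$ is a $\Gamma$-BMRS with heads $\pi(\sigma,i)$ ($\sigma\in\Sigma$, $i<m$); it is well-defined if for all $s\in\Gamma^\star$, $i<m$, $x<|s|$, $s,x\vdash\pi(\sigma,i)\to\top$ for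 at most one $\sigma$ and $\to\bot$ for all other characters, and strict if exactly one such $\sigma$ exists. For strict $\pi$, $[\![\pi]\!](s)$ has length $m|s|$ and carries $\sigma$ at position $mq+r$ ($q<|s|$, $r<m$) iff $s,q\vdash\pi(\sigma,r)\to\top$. Normal form: every occurrence of $\max$, $\min$ or a character predicate is applied to $\mathtt{x}$, and every recursive call has the form $\mathtt{f}(\mathtt{x})$, $\mathtt{f}(\mathrm{S}\mathtt{x})$ or $\mathtt{f}(\mathrm{P}\mathtt{x})$ (in body and heads). Blanks: $\square$ is a fresh symbol, $\Sigma_\square=\Sigma\cup\{\square\}$, $\Gamma_\square=\Gamma\cup\{\square\}$, and $d$ deletes all occurrences of $\square$ from a string. Blank enrichment: $\mathrm{maxc},\mathrm{minc}$ are recursive functions such that at a non-blank index $x$ of $s\in\Gamma_\square^\star$, $\mathrm{maxc}(x)\to\top$ iff no non-blank index exceeds $x$ (else $\to\bot$), symmetrically for $\mathrm{minc}$ (e.g. $\mathrm{maxc}(\mathtt{x})=\mathtt{if}\ \square(\mathtt{x})\ \mathtt{then}\ \mathtt{ff}\ \mathtt{else}\ \mathtt{g}(\mathtt{x})$, $\mathtt{g}(\mathtt{x})=\mathtt{if}\ \max(\mathtt{x})\ \mathtt{then}\ \mathtt{tt}\ \mathtt{else}\ \mathtt{h}(\mathrm{S}\mathtt{x})$, $\mathtt{h}(\mathtt{x})=\mathtt{if}\ \square(\mathtt{x})\ \mathtt{then}\ \mathtt{g}(\mathtt{x})\ \mathtt{else}\ \mathtt{ff}$). For normal-form boolean terms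 define $T^\star$: $\mathtt{tt}^\star=\mathtt{tt}$, $\mathtt{ff}^\star=\mathtt{ff}$, $\gamma(\mathtt{x})^\star=\gamma(\mathtt{x})$, $\max(\mathtt{x})^\star=\mathrm{maxc}(\mathtt{x})$, $\min(\mathtt{x})^\star=\mathrm{minc}(\mathtt{x})$, $\mathtt{f}(\mathtt{x})^\star=\mathtt{f}^\star(\mathtt{x})$, $\mathtt{f}(\mathrm{S}\mathtt{x})^\star=\mathtt{f}^S(\mathrm{S}\mathtt{x})$, $\mathtt{f}(\mathrm{P}\mathtt{x})^\star=\mathtt{f}^P(\mathrm{P}\mathtt{x})$, and $\star$ commutes with if-then-else, where $\mathtt{f}^\star,\mathtt{f}^S,\mathtt{f}^P$ are fresh names. If the body of $\pi$ is $p=\{\mathtt{f}_i(\mathtt{x})=T_i\}$, then $p^\star$ consists of $\mathtt{f}_i^\star(\mathtt{x})=T_i^\star$, $\mathtt{f}_i^S(\mathtt{x})=\mathtt{if}\ \square(\mathtt{x})\ \mathtt{then}\ \mathtt{f}_i^S(\mathrm{S}\mathtt{x})\ \mathtt{else}\ T_i^\star$, $\mathtt{f}_i^P(\mathtt{x})=\mathtt{if}\ \square(\mathtt{x})\ \mathtt{then}\ \mathtt{f}_i^P(\mathrm{P}\mathtt{x})\ \mathtt{else}\ T_i^\star$, plus the definitions of $\mathrm{maxc},\mathrm{minc}$. The interpretation $\pi_b:\Sigma_\square\times m\to\Gamma_\square$ has body $p^\star$, heads $\pi_b(\sigma,i)=\mathtt{if}\ \square(\mathtt{x})\ \mathtt{then}\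 \mathtt{ff}\ \mathtt{else}\ \pi(\sigma,i)^\star$ for $\sigma\in\Sigma$, and $\pi_b(\square,i)=\mathtt{if}\ \square(\mathtt{x})\ \mathtt{then}\ \mathtt{tt}\ \mathtt{else}\ \pi(\square,i)^\star$, for $i<m$.
   Formalization: Since π_b can diverge on strings with leading or trailing blanks, the equation is proved for every s on which [[π_b]](s) is defined, and π_b is proved well-defined and strict on s when s is all blanks or its first and last symbols are non-blank. *)

(* Defs.v *)
From HB Require Import structures.
From mathcomp Require Import all_boot.

Set Implicit Arguments.
Unset Strict Implicit.
Unset Printing Implicit Defensive.

(** * Boolean monadic recursive schemes

    A string is a [seq C]; its domain is the set of indices [x < size s]. *)

Definition succ_ix (C : Type) (s : seq C) (x : nat) : nat :=
  if x.+1 < size s then x.+1 else x.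

Definition pred_ix (x : nat) : nat := x.-1.

Definition is_max (C : Type) (s : seq C) (x : nat) : bool := x.+1 == size s.

Definition is_min (x : nat) : bool := x == 0.

Definition carries (C : eqType) (s : seq C) (x : nat) (c : C) : bool :=
  onth s x == Some c.

(** Terms over the single variable [IVar]; [C] is the alphabet and [F] the set
    of recursive names. *)
Inductive iterm (C F : Type) : Type :=
| IVar
| ISucc of iterm C F
| IPred of iterm C F
| IIte of bterm C F & iterm C F & iterm C F
with bterm (C F : Type) : Type :=
| BTrue
| BFalse
| BCall of F & iterm C F
| BChar of C & iterm C F
| BMax of iterm C F
| BMin of iterm C F
| BIte of bterm C F & bterm C F & bterm C F.

Arguments IVar {C F}.
Arguments BTrue {C F}.
Arguments BFalse {C F}.
Arguments BCall {C F}.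
Arguments BChar {C F}.

(** A headless BMRS with finite set of names [F] is a function [p] giving, for
    each name [f], the right-hand side of the definition of [f].  The judgement
    [s, x |- T -> v] is [ieval p s x T v] or [beval p s x T v]. *)
Inductive ieval (C : eqType) (F : Type) (p : F -> bterm C F) (s : seq C) :
    nat -> iterm C F -> nat -> Prop :=
| EVar x : ieval p s x IVar x
| ESucc x T v : ieval p s x T v -> ieval p s x (ISucc T) (succ_ix s v)
| EPred x T v : ieval p s x T v -> ieval p s x (IPred T) (pred_ix v)
| EIIteT x B T U v :
    beval p s x B true -> ieval p s x T v -> ieval p s x (IIte B T U) v
| EIIteF x B T U v :
    beval p s x B false -> ieval p s x U v -> ieval p s x (IIte B T U) v
with beval (C : eqType) (F : Type) (p : F -> bterm C F) (s : seq C) :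
    nat -> bterm C F -> bool -> Prop :=
| ETrue x : beval p s x BTrue true
| EFalse x : beval p s x BFalse false
| ECall x f T v b :
    ieval p s x T v -> beval p s v (p f) b -> beval p s x (BCall f T) b
| EChar x c T v : ieval p s x T v -> beval p s x (BChar c T) (carries s v c)
| EMax x T v : ieval p s x T v -> beval p s x (BMax T) (is_max s v)
| EMin x T v : ieval p s x T v -> beval p s x (BMin T) (is_min v)
| EBIteT x B T U b :
    beval p s x B true -> beval p s x T b -> beval p s x (BIte B T U) b
| EBIteF x B T U b :
    beval p s x B false -> beval p s x U b -> beval p s x (BIte B T U) b.

(** An interpretation [Sigma * m -> Gamma]. *)
Record interpretation (Sigma Gamma : finType) (m : nat) : Type :=
  Interpretation {
    names : finType;
    body : names -> bterm Gamma names;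
    head_term : Sigma -> 'I_m -> bterm Gamma names
  }.

Arguments names {Sigma Gamma m}.
Arguments body {Sigma Gamma m}.
Arguments head_term {Sigma Gamma m}.

Definition head_eval (Sigma Gamma : finType) (m : nat)
    (pi : interpretation Sigma Gamma m) (s : seq Gamma) (x : nat)
    (sigma : Sigma) (i : 'I_m) (b : bool) : Prop :=
  beval (body pi) s x (head_term pi sigma i) b.

Definition well_defined_on (Sigma Gamma : finType) (m : nat)
    (pi : interpretation Sigma Gamma m) (s : seq Gamma) : Prop :=
  forall (i : 'I_m) (x : nat), x < size s ->
    (forall sigma tau : Sigma,
       head_eval pi s x sigma i true -> head_eval pi s x tau i true ->
       sigma = tau) /\
    (forall sigma : Sigma,
       head_eval pi s x sigma i true \/ head_eval pi s x sigma i false).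

Definition strict_on (Sigma Gamma : finType) (m : nat)
    (pi : interpretation Sigma Gamma m) (s : seq Gamma) : Prop :=
  forall (i : 'I_m) (x : nat), x < size s ->
    exists! sigma : Sigma, head_eval pi s x sigma i true.

Definition well_defined (Sigma Gamma : finType) (m : nat)
    (pi : interpretation Sigma Gamma m) : Prop :=
  forall s : seq Gamma, well_defined_on pi s.

Definition strict (Sigma Gamma : finType) (m : nat)
    (pi : interpretation Sigma Gamma m) : Prop :=
  forall s : seq Gamma, strict_on pi s.

(** [denotes pi s t] is the graph of the partial function [[pi]], i.e. it says
    that [[pi]](s) is defined and equal to [t]. It is functional
    ([denotes_inj]), and total on the strings where [pi] is strict
    ([denotes_total]). *)
Definition denotes (Sigma Gamma : finType) (m : nat)
    (pi : interpretation Sigma Gamma m) (s : seq Gamma) (t : seq Sigma) : Prop :=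
  size t = m * size s /\
  forall (q : nat) (r : 'I_m) (sigma : Sigma), q < size s ->
    (carries t (m * q + r) sigma <-> head_eval pi s q sigma r true).

(** * Normal form *)

Definition is_var (C F : Type) (T : iterm C F) : bool :=
  if T is IVar then true else false.

Definition is_step (C F : Type) (T : iterm C F) : bool :=
  match T with IVar | ISucc IVar | IPred IVar => true | _ => false end.

Fixpoint normal_term (C F : Type) (T : bterm C F) : bool :=
  match T with
  | BTrue | BFalse => true
  | BCall _ U => is_step U
  | BChar _ U | BMax U | BMin U => is_var U
  | BIte B T1 T2 => [&& normal_term B, normal_term T1 & normal_term T2]
  end.

Definition normal_form (Sigma Gamma : finType) (m : nat)
    (pi : interpretation Sigma Gamma m) : Prop :=
  (forall f, normal_term (body pi f)) /\
  (forall sigma i, normal_term (head_term pi sigma i)).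

(** * Blanks: [option A] is the alphabet [A] extended with the blank [None]. *)

Definition del_blanks (A : Type) (s : seq (option A)) : seq A := pmap id s.

Definition outer_nonblank (A : eqType) (s : seq (option A)) : bool :=
  all (pred1 None) s || (head None s != None) && (last None s != None).

(** An arbitrary implementation of maxc and minc; they are constrained only at
    non-blank indices. *)
Record blank_extrema (Gamma : finType) : Type := BlankExtrema {
  aux : finType;
  aux_body : aux -> bterm (option Gamma) aux;
  maxc : aux;
  minc : aux;
  maxcP : forall (s : seq (option Gamma)) (x : nat),
    x < size s -> ~~ carries s x None ->
    beval aux_body s x (BCall maxc IVar) (all (pred1 None) (drop x.+1 s));
  mincP : forall (s : seq (option Gamma)) (x : nat),
    x < size s -> ~~ carries s x None ->
    beval aux_body s x (BCall minc IVar) (all (pred1 None) (take x s))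
}.

Arguments aux {Gamma}.
Arguments aux_body {Gamma}.
Arguments maxc {Gamma}.
Arguments minc {Gamma}.

(** The usual implementation, with names [(fwd, None)] for maxc (if [fwd]) or
    minc, [(fwd, Some true)] for g and [(fwd, Some false)] for h. *)
Definition extrema_body (C : Type) (n : bool * option bool) :
    bterm (option C) (bool * option bool) :=
  let: (fwd, st) := n in
  let blank := BChar None IVar in
  match st with
  | None => BIte blank BFalse (BCall (fwd, Some true) IVar)
  | Some true =>
      BIte (if fwd then BMax IVar else BMin IVar) BTrue
           (BCall (fwd, Some false) (if fwd then ISucc IVar else IPred IVar))
  | Some false => BIte blank (BCall (fwd, Some true) IVar) BFalse
  end.

Lemma extrema_blank (C : eqType) (s : seq (option C)) (x : nat) T U b :
  beval (@extrema_body C) s x (if carries s x None then T else U) b ->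
  beval (@extrema_body C) s x (BIte (BChar None IVar) T U) b.
Proof.
have H : beval (@extrema_body C) s x (BChar None IVar) (carries s x None).
  by apply: EChar; apply: EVar.
by case: carries H => H ?; [apply: EBIteT | apply: EBIteF].
Qed.

Lemma extrema_maxP (C : eqType) (s : seq (option C)) (x : nat) :
  x < size s ->
  beval (@extrema_body C) s x (BCall (true, Some true) IVar)
    (all (pred1 None) (drop x.+1 s)).
Proof.
move=> ltx; have [n] := ubnP (size s - x); elim: n x ltx => // n IHn x ltx ltn.
apply: ECall; first exact: EVar.
have H : beval (@extrema_body C) s x (BMax IVar) (is_max s x).
  by apply: EMax; apply: EVar.
move: H; rewrite /is_max.
have [ltx1 | lex1] := ltnP x.+1 (size s).
  rewrite (ltn_eqF ltx1) => H; apply: EBIteF => //.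
  apply: ECall; first by apply: ESucc; apply: EVar.
  rewrite /succ_ix ltx1 (drop_nth None) //=; apply: extrema_blank.
  rewrite {1}/carries (onthE s) (nth_map None) //.
  have -> : (Some (nth None s x.+1) == Some None) = (nth None s x.+1 == None).
    by [].
  case: eqP => _ /=; last exact: EFalse.
  apply: IHn => //; rewrite -ltnS; apply: leq_trans ltn.
  by rewrite ltnS ltn_sub2l.
by rewrite eqn_leq ltx lex1 drop_oversize //= => H; apply: EBIteT => //; apply: ETrue.
Qed.

Lemma extrema_minP (C : eqType) (s : seq (option C)) (x : nat) :
  x < size s ->
  beval (@extrema_body C) s x (BCall (false, Some true) IVar)
    (all (pred1 None) (take x s)).
Proof.
elim: x => [|x IHx] ltx; (apply: ECall; first exact: EVar).
  rewrite take0; apply: EBIteT; last exact: ETrue.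
  by apply: (EMin (v := 0)); apply: EVar.
apply: EBIteF; first by apply: (EMin (v := x.+1)); apply: EVar.
apply: ECall; first by apply: EPred; apply: EVar.
have ltx' := ltnW ltx.
rewrite (take_nth None) // all_rcons /pred_ix /=; apply: extrema_blank.
rewrite {1}/carries (onthE s) (nth_map None) //.
have -> : (Some (nth None s x) == Some None) = (nth None s x == None) by [].
by case: eqP => _ /=; [apply: IHx | apply: EFalse].
Qed.

Definition usual_extrema (Gamma : finType) : blank_extrema Gamma.
Proof.
apply: (@BlankExtrema Gamma (bool * option bool)%type (@extrema_body Gamma)
  (true, None) (false, None)) => s x ltx nb;
  (apply: ECall; [exact: EVar | apply: extrema_blank; rewrite (negPf nb)]).
  exact: extrema_maxP.
exact: extrema_minP.
Defined.

(** The names of the enriched scheme: [Star f], [StarS f], [StarP f] for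
    the three copies of [f], and the names used to compute maxc and minc. *)
Inductive star_name (F A : Type) : Type :=
| Star of F
| StarS of F
| StarP of F
| Aux of A.

Arguments Star {F A}.
Arguments StarS {F A}.
Arguments StarP {F A}.
Arguments Aux {F A}.

Definition star_name_code (F A : Type) (n : star_name F A) : F + F + F + A :=
  match n with
  | Star f => inl (inl (inl f))
  | StarS f => inl (inl (inr f))
  | StarP f => inl (inr f)
  | Aux a => inr a
  end.

Definition star_name_decode (F A : Type) (c : F + F + F + A) : star_name F A :=
  match c with
  | inl (inl (inl f)) => Star f
  | inl (inl (inr f)) => StarS f
  | inl (inr f) => StarP f
  | inr a => Aux a
  end.

Lemma star_name_codeK (F A : Type) :
  cancel (@star_name_code F A) (@star_name_decode F A).
Proof. by case. Qed.

HB.instance Definition _ (F A : finType) :=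
  Finite.copy (star_name F A) (can_type (@star_name_codeK F A)).

Fixpoint irename (C F G : Type) (h : F -> G) (T : iterm C F) : iterm C G :=
  match T with
  | IVar => IVar
  | ISucc U => ISucc (irename h U)
  | IPred U => IPred (irename h U)
  | IIte B U V => IIte (brename h B) (irename h U) (irename h V)
  end
with brename (C F G : Type) (h : F -> G) (T : bterm C F) : bterm C G :=
  match T with
  | BTrue => BTrue
  | BFalse => BFalse
  | BCall f U => BCall (h f) (irename h U)
  | BChar c U => BChar c (irename h U)
  | BMax U => BMax (irename h U)
  | BMin U => BMin (irename h U)
  | BIte B U V => BIte (brename h B) (brename h U) (brename h V)
  end.

(** [T |-> T^*], for [T] in normal form; the value on other terms is
    irrelevant. *)
Fixpoint star (Gamma : finType) (e : blank_extrema Gamma) (F : Type)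
    (T : bterm Gamma F) : bterm (option Gamma) (star_name F (aux e)) :=
  match T with
  | BTrue => BTrue
  | BFalse => BFalse
  | BCall f (ISucc _) => BCall (StarS f) (ISucc IVar)
  | BCall f (IPred _) => BCall (StarP f) (IPred IVar)
  | BCall f _ => BCall (Star f) IVar
  | BChar c _ => BChar (Some c) IVar
  | BMax _ => BCall (Aux (maxc e)) IVar
  | BMin _ => BCall (Aux (minc e)) IVar
  | BIte B U V => BIte (star e B) (star e U) (star e V)
  end.

Definition if_blank (Gamma : finType) (F : Type)
    (T U : bterm (option Gamma) F) : bterm (option Gamma) F :=
  BIte (BChar None IVar) T U.

Definition star_body (Gamma : finType) (e : blank_extrema Gamma) (F : Type)
    (p : F -> bterm Gamma F) (n : star_name F (aux e)) :
    bterm (option Gamma) (star_name F (aux e)) :=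
  match n with
  | Star f => star e (p f)
  | StarS f => if_blank (BCall (StarS f) (ISucc IVar)) (star e (p f))
  | StarP f => if_blank (BCall (StarP f) (IPred IVar)) (star e (p f))
  | Aux a => brename Aux (aux_body e a)
  end.

(** The interpretation [pi_b].  Even for a strict [pi] in normal form it need
    not be strict on strings with leading or trailing blanks: with the single
    definition [f(x) = tt] and a head [pi(sigma, i) = f(S x)], the head
    [pi_b(sigma, i)] has no value at index 0 of the string [a] followed by a
    blank, because [f^S] calls itself forever at the last index.  Its meaning
    is thus only a partial function. *)
Definition blank_enrichment (Sigma Gamma : finType) (m : nat)
    (e : blank_extrema Gamma)
    (pi : interpretation (option Sigma) Gamma m) :
    interpretation (option Sigma) (option Gamma) m :=
  @Interpretation (option Sigma) (option Gamma) m
    (star_name (names pi) (aux e))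
    (star_body (e := e) (body pi))
    (fun sigma i =>
       if_blank (if sigma is Some _ then BFalse else BTrue)
                (star e (head_term pi sigma i))).

(** * Sanity facts *)

Lemma denotes_inj (Sigma Gamma : finType) (m : nat)
    (pi : interpretation Sigma Gamma m) (s : seq Gamma) (t u : seq Sigma) :
  denotes pi s t -> denotes pi s u -> t = u.
Proof.
case=> szt Ht [szu Hu].
apply: eq_from_onth => k; have [ltk | lek] := ltnP k (m * size s); last first.
  by rewrite !onth_default ?szt ?szu.
have m0 : 0 < m by case: (m) ltk => //; rewrite mul0n.
have ltq : k %/ m < size s by rewrite ltn_divLR // mulnC.
have ek : m * (k %/ m) + k %% m = k by rewrite mulnC -divn_eq.
case Etk: (onth t k) => [sigma|]; last first.
  by have := onthTE t k; rewrite Etk szt ltk.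
have := Ht _ (Ordinal (ltn_pmod k m0)) sigma ltq.
have := Hu _ (Ordinal (ltn_pmod k m0)) sigma ltq.
rewrite /carries /= ek Etk eqxx => -[_ Hus] [/(_ isT)/Hus/eqP-> _].
by [].
Qed.

Lemma denotes_total (Sigma Gamma : finType) (m : nat)
    (pi : interpretation Sigma Gamma m) (s : seq Gamma) :
  strict_on pi s -> exists t : seq Sigma, denotes pi s t.
Proof.
move=> H.
have [g Hg] : exists g : 'I_m -> 'I_(size s) -> Sigma,
    forall (i : 'I_m) (x : 'I_(size s)),
    unique (fun sigma => head_eval pi s x sigma i true) (g i x).
  apply: (@fin_all_exists _ _ (fun i g => forall x : 'I_(size s),
    unique (fun sigma => head_eval pi s x sigma i true) (g x))) => i.
  apply: (@fin_all_exists _ _ (fun x : 'I_(size s) =>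
    unique (fun sigma => head_eval pi s x sigma i true))) => x.
  exact: H.
case: (posnP m) => [em | m0].
  exists [::]; split; first by rewrite em.
  by move=> q [r ltr]; case: (notF); rewrite em in ltr.
case: (posnP (size s)) => [es | s0].
  by exists [::]; split=> [|q r sigma]; rewrite es ?muln0.
exists (mkseq (fun k => g (Ordinal (ltn_pmod k m0))
  (Ordinal (ltn_pmod (k %/ m) s0))) (m * size s)).
split=> [|q r sigma ltq]; first by rewrite size_mkseq.
have ltk : m * q + r < m * size s.
  by rewrite (leq_trans (n := m * q.+1)) ?leq_mul2l ?ltq ?orbT //
     mulnS addnC ltn_add2r.
have er : Ordinal (ltn_pmod (m * q + r) m0) = r.
  by apply: val_inj; rewrite /= mulnC modnMDl modn_small.
have eq : Ordinal (ltn_pmod ((m * q + r) %/ m) s0) = Ordinal ltq.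
  by apply: val_inj; rewrite /= mulnC divnMDl // divn_small // addn0 modn_small.
have sz : m * q + r < size (mkseq (fun k => g (Ordinal (ltn_pmod k m0))
  (Ordinal (ltn_pmod (k %/ m) s0))) (m * size s)) by rewrite size_mkseq.
rewrite /carries onthE (nth_map (g r (Ordinal ltq))) // nth_mkseq // er eq.
have [Hv Hu] := Hg r (Ordinal ltq).
by split=> [/eqP[<-] // | /Hu ->].
Qed.

(* Main.v *)
(** Let [rank s x] be the number of non-blank indices of [s] below [x].  On any
    string, whatever the enriched scheme computes at a non-blank index [x] is what
    [pi] computes on [d(s)] at [rank s x]; a search past the outermost non-blank
    index diverges and computes nothing.  This gives the equality of outputs block
    by block.  When the outer symbols are not blank no search diverges, the converse
    holds too, and the enriched scheme inherits well-definedness and strictness. *)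

Require Import Defs.
From mathcomp Require Import all_boot.

Set Implicit Arguments.
Unset Strict Implicit.
Unset Printing Implicit Defensive.

(* Determinism and renaming of evaluations *)
Scheme ieval_mut := Minimality for ieval Sort Prop
  with beval_mut := Minimality for beval Sort Prop.
Combined Scheme eval_mut from ieval_mut, beval_mut.

(** By mutual induction on the first derivation; if the second takes the other branch, the induction
    hypothesis on the guard would identify [true] with [false]. *)
Lemma eval_fun (C : eqType) (F : Type) (p : F -> bterm C F) (s : seq C) :
  (forall x T v, ieval p s x T v -> forall v', ieval p s x T v' -> v = v') /\
  (forall x T b, beval p s x T b -> forall b', beval p s x T b' -> b = b').
Proof.
apply: eval_mut => //.
- by move=> x v' H; inversion H.
- by move=> x T v _ IH v' H; inversion H; subst; rewrite (IH v0).
- by move=> x T v _ IH v' H; inversion H; subst; rewrite (IH v0).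
- move=> x B T U v _ IHB _ IH v' H; inversion H; subst; first exact: IH.
  by have := IHB false ltac:(assumption).
- move=> x B T U v _ IHB _ IH v' H; inversion H; subst; last exact: IH.
  by have := IHB true ltac:(assumption).
- by move=> x b H; inversion H.
- by move=> x b H; inversion H.
- move=> x f T v b _ IHT _ IH b' H; inversion H; subst.
  by apply: IH; rewrite (IHT v0).
- by move=> x c T v _ IH b' H; inversion H; subst; rewrite (IH v0).
- by move=> x T v _ IH b' H; inversion H; subst; rewrite (IH v0).
- by move=> x T v _ IH b' H; inversion H; subst; rewrite (IH v0).
- move=> x B T U v _ IHB _ IH v' H; inversion H; subst; first exact: IH.
  by have := IHB false ltac:(assumption).
- move=> x B T U v _ IHB _ IH v' H; inversion H; subst; last exact: IH.
  by have := IHB true ltac:(assumption).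
Qed.

Lemma beval_fun {C : eqType} {F : Type} {p : F -> bterm C F} {s : seq C} {x T b b'} :
  beval p s x T b -> beval p s x T b' -> b = b'.
Proof. by move=> H; apply: (proj2 (eval_fun p s) _ _ _ H). Qed.

(** Only the call rule consults the scheme. This carries the specifications of [maxc] and [minc]
    over to the enriched scheme. *)
Lemma eval_rename (C : eqType) (F G : Type) (h : F -> G) (p : F -> bterm C F)
    (q : G -> bterm C G) (s : seq C) :
  (forall f, q (h f) = brename h (p f)) ->
  (forall x T v, ieval p s x T v -> ieval q s x (irename h T) v) /\
  (forall x T b, beval p s x T b -> beval q s x (brename h T) b).
Proof.
move=> qh; apply: eval_mut => /=; try by econstructor; eauto.
by move=> x f T v b _ HT _ Hb; apply: ECall HT _; rewrite qh.
Qed.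

Lemma ieval_var (C : eqType) (F : Type) (p : F -> bterm C F) (s : seq C) x v :
  ieval p s x IVar v -> v = x.
Proof. by move=> H; inversion H. Qed.

Lemma ieval_succ_var (C : eqType) (F : Type) (p : F -> bterm C F) (s : seq C) x v :
  ieval p s x (ISucc IVar) v -> v = succ_ix s x.
Proof. by move=> H; inversion H; subst; rewrite (@ieval_var _ _ p s x v0). Qed.

Lemma ieval_pred_var (C : eqType) (F : Type) (p : F -> bterm C F) (s : seq C) x v :
  ieval p s x (IPred IVar) v -> v = pred_ix x.
Proof. by move=> H; inversion H; subst; rewrite (@ieval_var _ _ p s x v0). Qed.

Lemma succ_ix_lt (C : Type) (s : seq C) x : x < size s -> succ_ix s x < size s.
Proof. by rewrite /succ_ix; case: ifP. Qed.

Lemma pred_ix_lt (C : Type) (s : seq C) x : x < size s -> pred_ix x < size s.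
Proof. exact/leq_ltn_trans/leq_pred. Qed.

Lemma beval_if_blank (Gamma : finType) (F : Type) (p : F -> bterm (option Gamma) F)
    (s : seq (option Gamma)) x T U b :
  beval p s x (if_blank T U) b <->
  beval p s x (if carries s x None then T else U) b.
Proof.
have E : beval p s x (BChar None IVar) (carries s x None).
  by apply: EChar; apply: EVar.
split=> [H | ].
  by inversion H; subst; rewrite (beval_fun E ltac:(eassumption)).
by case: carries E => E ?; [apply: EBIteT | apply: EBIteF].
Qed.

(** * Ranks of indices and deletion of blanks *)

Section Rank.
Variables (A : eqType).
Implicit Types s : seq (option A).

Definition rank s x := size (del_blanks (take x s)).

Lemma rank0 s : rank s 0 = 0.
Proof. by rewrite /rank take0. Qed.

Lemma rank_size s : rank s (size s) = size (del_blanks s).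
Proof. by rewrite /rank take_size. Qed.

Lemma del_blanks_cat s t : del_blanks (s ++ t) = del_blanks s ++ del_blanks t.
Proof. exact: pmap_cat. Qed.

Lemma size_del_blanks_eq0 s : (size (del_blanks s) == 0) = all (pred1 None) s.
Proof. by elim: s => [|[a|] s IHs]. Qed.

Lemma carries_nth s x c : x < size s -> carries s x c = (nth None s x == c).
Proof. by move=> ltx; rewrite /carries onthE (nth_map None). Qed.

Lemma rankS s x : x < size s -> rank s x.+1 = rank s x + ~~ carries s x None.
Proof.
move=> ltx; rewrite carries_nth // /rank (take_nth None) // -cats1.
by rewrite del_blanks_cat size_cat; case: nth.
Qed.

Lemma rank_le s x y : x <= y -> rank s x <= rank s y.
Proof.
move=> lexy; rewrite -(subnKC lexy) /rank takeD del_blanks_cat size_cat.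
exact: leq_addr.
Qed.

Lemma rank_lt s x :
  x < size s -> ~~ carries s x None -> rank s x < size (del_blanks s).
Proof.
by move=> ltx nb; rewrite -rank_size (leq_trans _ (rank_le s ltx)) // rankS // nb addn1.
Qed.

(** Cut [s] at [x]: the left part leaves [rank s x] symbols after deletion, and the symbol at [x]
    comes right after them. *)
Lemma carries_rank s x c : x < size s -> ~~ carries s x None ->
  carries (del_blanks s) (rank s x) c = carries s x (Some c).
Proof.
move=> ltx; rewrite !carries_nth // -[in del_blanks s](cat_take_drop x s).
rewrite (drop_nth None) // del_blanks_cat /rank /carries.
case: nth => //= a _; rewrite onthE map_cat nth_cat size_map ltnn subnn /=.
by [].
Qed.

Lemma is_max_rank s x : x < size s -> ~~ carries s x None ->
  is_max (del_blanks s) (rank s x) = all (pred1 None) (drop x.+1 s).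
Proof.
move=> ltx nb; rewrite /is_max -size_del_blanks_eq0.
rewrite -[in del_blanks s](cat_take_drop x.+1 s) del_blanks_cat size_cat.
by rewrite -/(rank s x.+1) rankS // nb addn1 -[X in X == _]addn0 eqn_add2l eq_sym.
Qed.

Lemma is_min_rank s x : is_min (rank s x) = all (pred1 None) (take x s).
Proof. exact: size_del_blanks_eq0. Qed.

Lemma rank_succ_ix_blank s x :
  x < size s -> carries s x None -> rank s (succ_ix s x) = rank s x.
Proof.
by move=> ltx bl; rewrite /succ_ix; case: ifP => // _; rewrite rankS // bl addn0.
Qed.

(** [rank s y.+1] counts [y] itself and is the invariant of the leftward search; at index 0 the
    equation is trivial, as [pred_ix] fixes 0. *)
Lemma rank_pred_ix_blank s x : x < size s -> carries s x None ->
  rank s (pred_ix x).+1 = rank s x.+1.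
Proof. by case: x => // x ltx bl; rewrite /= [RHS]rankS // bl addn0. Qed.

(** The bound excludes a non-last [x] followed by blanks only, where the right side would pass the
    end of [del_blanks s]. At the last index of [s] both steps stay put. *)
Lemma succ_ix_rank s x : x < size s -> ~~ carries s x None ->
  rank s (succ_ix s x) < size (del_blanks s) ->
  succ_ix (del_blanks s) (rank s x) = rank s (succ_ix s x).
Proof.
move=> ltx nb; have := rankS ltx; rewrite nb addn1 /succ_ix => <-.
case: (ltnP x.+1 (size s)) => [_ -> // | lex _].
by rewrite -rank_size ltnNge rank_le.
Qed.

(** Truncated predecessors agree when only blanks precede [x]: both sides are then 0. *)
Lemma pred_ix_rank s x : x < size s -> ~~ carries s x None ->
  pred_ix (rank s x) = (rank s (pred_ix x).+1).-1.
Proof. by case: x => [|x] ltx nb //=; rewrite rankS // rank0 nb. Qed.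

(** A non-blank [x] rules out the all-blank alternative, so the last symbol is non-blank and its
    rank bounds that of the index reached. *)
Lemma outer_nonblank_succ s x : outer_nonblank s ->
  x < size s -> ~~ carries s x None -> rank s (succ_ix s x) < size (del_blanks s).
Proof.
move=> out ltx nb; rewrite /succ_ix.
case: (ltnP x.+1) => [ltx1 | _]; last exact: rank_lt.
have s0 : (size s).-1 < size s by rewrite ltn_predL (leq_trans _ ltx).
have nb_last : ~~ carries s (size s).-1 None.
  case/orP: out => [/allP/(_ _ (mem_nth None ltx)) | /andP[_]].
    by rewrite /= -carries_nth // (negPf nb).
  by rewrite carries_nth // nth_last.
apply: leq_ltn_trans (rank_lt s0 nb_last).
by apply: rank_le; rewrite -ltnS prednK // (leq_trans _ ltx).
Qed.

Lemma outer_nonblank_pred s x : outer_nonblank s ->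
  x < size s -> ~~ carries s x None -> 0 < rank s (pred_ix x).+1.
Proof.
move=> out ltx nb; have s0 := leq_ltn_trans (leq0n x) ltx.
apply: (@leq_trans (rank s 1)); last exact: rank_le.
rewrite rankS // rank0.
case/orP: out => [/allP/(_ _ (mem_nth None ltx)) | /andP[+ _]].
  by rewrite /= -carries_nth // (negPf nb).
by rewrite carries_nth // nth0 => ->.
Qed.

End Rank.

(** Induction on [s], one block of length [m] at a time: a blank head consumes an all-blank block of
    [t], any other head consumes equal blocks of [t] and [u]. *)
Lemma del_blanks_blocks (A B : eqType) m (s : seq (option A)) (t u : seq (option B)) :
  size t = m * size s -> size u = m * size (del_blanks s) ->
  (forall q r, q < size s -> r < m -> nth None t (m * q + r) =
     if carries s q None then None else nth None u (m * rank s q + r)) ->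
  del_blanks t = del_blanks u.
Proof.
elim: s t u => [|a s IHs] t u.
  by rewrite !muln0 => /size0nil-> /size0nil->.
move=> szt szu H; rewrite -(cat_take_drop m t) [LHS]pmap_cat.
have szt1 : size (take m t) = m by rewrite size_takel // szt mulnS leq_addr.
have sztd : size (drop m t) = m * size s by rewrite size_drop szt mulnS addKn.
case: a szt szu H => [a|] szt szu H.
- have szu1 : size (take m u) = m by rewrite size_takel // szu mulnS leq_addr.
  rewrite -(cat_take_drop m u) [RHS]pmap_cat; congr (_ ++ _).
    congr (pmap _ _); apply: (@eq_from_nth _ None); first by rewrite szt1 szu1.
    rewrite szt1 => r ltr; rewrite !nth_take //.
    by have := H 0 r isT ltr; rewrite rank0 muln0 !add0n.
  apply: IHs => [||q r ltq ltr] //; first by rewrite size_drop szu mulnS addKn.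
  (* Past a non-blank head the rank is one larger, which matches the [m] symbols dropped from
     [u]. *)
  by have := H q.+1 r ltq ltr; rewrite !nth_drop /rank /= !mulnS !addnA.
have -> : pmap id (take m t) = [::].
  apply/size0nil/eqP; rewrite size_del_blanks_eq0.
  apply/(all_nthP None) => r; rewrite szt1 => ltr; rewrite nth_take //.
  by have /= := H 0 r isT ltr; rewrite muln0 add0n => ->.
apply: IHs => [||q r ltq ltr] //.
by have := H q.+1 r ltq ltr; rewrite !nth_drop /rank /= !mulnS !addnA.
Qed.

(** * Soundness and completeness of the enriched scheme *)

Section Enrichment.
Variables (Gamma : finType) (e : blank_extrema Gamma) (F : Type).
Variables (p : F -> bterm Gamma F) (s : seq (option Gamma)).
Hypothesis p_nf : forall f, normal_term (p f).

Local Notation q := (star_body (e := e) p).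
Local Notation w := (del_blanks s).

Lemma beval_aux x a b : beval (aux_body e) s x (BCall a IVar) b ->
  beval q s x (BCall (Aux a) IVar) b.
Proof. exact: (proj2 (eval_rename (q := q) (h := Aux) s _) x (BCall a IVar) b). Qed.

Lemma beval_maxc x : x < size s -> ~~ carries s x None ->
  beval q s x (BCall (Aux (maxc e)) IVar) (is_max w (rank s x)).
Proof. by move=> ltx nb; apply: beval_aux; rewrite is_max_rank //; apply: maxcP. Qed.

Lemma beval_minc x : x < size s -> ~~ carries s x None ->
  beval q s x (BCall (Aux (minc e)) IVar) (is_min (rank s x)).
Proof. by move=> ltx nb; apply: beval_aux; rewrite is_min_rank; apply: mincP. Qed.

Lemma beval_char_var x c (b : bool) :
  beval q s x (BChar c IVar) b -> b = carries s x c.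
Proof. by move=> H; inversion H; subst; rewrite (@ieval_var _ _ q s x v). Qed.

(* The last four clauses follow the searches through blanks: [rank s x] is the rank
   of the first non-blank index from [x] on, and [(rank s x.+1).-1] that of the last
   one up to [x], the bounds expressing that such an index exists. *)
Lemma star_sound_rec x T b : beval q s x T b -> x < size s ->
  [/\ forall T0, normal_term T0 -> T = star e T0 -> ~~ carries s x None ->
        beval p w (rank s x) T0 b,
      forall f, T = q (StarS f) ->
        rank s x < size w /\ beval p w (rank s x) (p f) b,
      forall f, T = q (StarP f) ->
        0 < rank s x.+1 /\ beval p w (rank s x.+1).-1 (p f) b,
      forall f, T = BCall (StarS f) (ISucc IVar) ->
        let y := succ_ix s x in
        rank s y < size w /\ beval p w (rank s y) (p f) b
    & forall f, T = BCall (StarP f) (IPred IVar) ->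
        let y := pred_ix x in
        0 < rank s y.+1 /\ beval p w (rank s y.+1).-1 (p f) b].
Proof.
(* Induction on boolean derivations alone suffices: the relevant index terms are a variable or one
   step from it, and are inverted directly. *)
elim=> {x T b}.
- move=> x ltx; split=> // -[||f []|c U|U|U|B U V] //= *; exact: ETrue.
- move=> x ltx; split=> // -[||f []|c U|U|U|B U V] //= *; exact: EFalse.
- move=> x f T v b HT Hb IH ltx; split=> //.
  + case=> [||g U|c U|U|U|B U V] //=.
    * case: U => [|[]|[]|] //= _ [ef eT] nb; subst.
      - rewrite (ieval_var HT) in IH; apply: ECall (EVar _ _ _) _.
        by case: (IH ltx) => /(_ (p g)) + _ _ _ _; apply.
      - rewrite (ieval_succ_var HT) in IH.
        case: (IH (succ_ix_lt ltx)) => _ /(_ g erefl)[ltw Hg] _ _ _.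
        apply: ECall (ESucc (EVar _ _ _)) _.
        by rewrite succ_ix_rank.
      rewrite (ieval_pred_var HT) in IH.
      case: (IH (pred_ix_lt ltx)) => _ _ /(_ g erefl)[_ Hg] _ _.
      apply: ECall (EPred (EVar _ _ _)) _.
      by rewrite pred_ix_rank.
    * case: U => //= _ [ef eT] nb; subst.
      (* The body of [maxc] is not followed: determinism forces the value given by its
         specification. *)
      rewrite (beval_fun (ECall HT Hb) (beval_maxc ltx nb)).
      by apply: EMax; apply: EVar.
    case: U => //= _ [ef eT] nb; subst.
    rewrite (beval_fun (ECall HT Hb) (beval_minc ltx nb)).
    by apply: EMin; apply: EVar.
  + move=> g [ef eT]; subst; rewrite (ieval_succ_var HT) in IH.
    by case: (IH (succ_ix_lt ltx)) => _ /(_ g erefl).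
  move=> g [ef eT]; subst; rewrite (ieval_pred_var HT) in IH.
  by case: (IH (pred_ix_lt ltx)) => _ _ /(_ g erefl).
- move=> x c T v HT ltx; split=> // -[||f []|c' U|U|U|B U V] //=.
  case: U => //= _ [ec eT] nb; subst.
  rewrite (ieval_var HT) -carries_rank //.
  by apply: EChar; apply: EVar.
(* [star] never yields [BMax] or [BMin], so this case and the next are vacuous. *)
- by move=> x T v HT ltx; split=> // -[||f []|c' U|U|U|B U V].
- by move=> x T v HT ltx; split=> // -[||f []|c' U|U|U|B U V].
- move=> x B T U b HB IHB HT IHT ltx.
  case: (IHB ltx) (IHT ltx) => IB _ _ _ _ [IT _ _ ITS ITP]; split=> //.
  + case=> [||f []|c V|V|V|B0 T0 U0] //= /and3P[nB nT nU] [eB eT eU] nb.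
    by apply: EBIteT; [apply: IB | apply: IT].
  (* The search is at a blank; moving on keeps the rank, so the fourth clause for the branch gives
     this one. *)
  + move=> f [eB eT eU]; subst; have bl := beval_char_var HB.
    by case: (ITS f erefl); rewrite /= rank_succ_ix_blank.
  move=> f [eB eT eU]; subst; have bl := beval_char_var HB.
  by case: (ITP f erefl); rewrite rank_pred_ix_blank.
move=> x B T U b HB IHB HU IHU ltx.
case: (IHB ltx) (IHU ltx) => IB _ _ _ _ [IU _ _ _ _]; split=> //.
- case=> [||f []|c V|V|V|B0 T0 U0] //= /and3P[nB nT nU] [eB eT eU] nb.
  by apply: EBIteF; [apply: IB | apply: IU].
(* The search stops at the non-blank [x], which itself witnesses the bound. *)
- move=> f [eB eT eU]; subst; have nb := negbT (esym (beval_char_var HB)).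
  by split; [exact: rank_lt | exact: IU].
move=> f [eB eT eU]; subst; have nb := negbT (esym (beval_char_var HB)).
by rewrite rankS // nb addn1; split=> //; exact: IU.
Qed.

Lemma star_sound x T b : normal_term T -> x < size s -> ~~ carries s x None ->
  beval q s x (star e T) b -> beval p w (rank s x) T b.
Proof.
by move=> nT ltx nb /star_sound_rec/(_ ltx)[/(_ T nT erefl nb)].
Qed.

(** Each step over a blank keeps the rank and shortens the distance to the end of [s]. *)
Lemma StarS_complete k f b : k < size w ->
  (forall x, x < size s -> ~~ carries s x None -> rank s x = k ->
     beval q s x (star e (p f)) b) ->
  forall z, z < size s -> rank s z = k -> beval q s z (q (StarS f)) b.
Proof.
move=> ltk H z; have [n] := ubnP (size s - z); elim: n z => // n IHn z ltn ltz rz.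
apply/beval_if_blank; case: ifPn => [bl | nb]; last exact: H.
apply: ECall (ESucc (EVar _ _ _)) _.
have rz1 : rank s z.+1 = k by rewrite rankS // bl addn0.
(* A blank at the last index would force [k = size w], against [ltk]; so the search cannot get stuck
   there. *)
have ltz1 : z.+1 < size s.
  by rewrite ltnNge; apply/negP => /(rank_le s); rewrite rz1 rank_size leqNgt ltk.
rewrite /succ_ix ltz1; apply: IHn => //.
by rewrite -ltnS (leq_trans _ ltn) // ltnS ltn_sub2l.
Qed.

(** The count up to and including [z] stays [k.+1] along the search; being positive, it rules out a
    blank at index 0, where the search would loop. *)
Lemma StarP_complete k f b :
  (forall x, x < size s -> ~~ carries s x None -> rank s x = k ->
     beval q s x (star e (p f)) b) ->
  forall z, z < size s -> rank s z.+1 = k.+1 -> beval q s z (q (StarP f)) b.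
Proof.
move=> H; elim=> [|z IHz] ltz rz; apply/beval_if_blank;
  case: ifPn => [bl | nb]; rewrite rankS // ?bl ?nb in rz.
- by rewrite rank0 in rz.
- by apply: H => //; rewrite addn1 in rz; case: rz.
- apply: ECall (EPred (EVar _ _ _)) _.
  by rewrite addn0 in rz; apply: IHz => //; exact: ltnW.
by apply: H => //; rewrite addn1 in rz; case: rz.
Qed.

(** Induction on the derivation over [w]. Non-blank outer symbols ensure that every search ends;
    quantifying over [x] gives the induction hypothesis the form that the search lemmas ask for. *)
Lemma star_complete k T b : beval p w k T b -> outer_nonblank s -> normal_term T ->
  forall x, x < size s -> ~~ carries s x None -> rank s x = k ->
  beval q s x (star e T) b.
Proof.
move=> HT out; elim: HT => {k T b}.
- by move=> *; exact: ETrue.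
- by move=> *; exact: EFalse.
- move=> k f U v b HU _ IH nU x ltx nb rx; subst k.
  case: U HU nU => [|[]|[]|] //= HU _.
  + apply: ECall (EVar _ _ _) _.
    by apply: IH => //; rewrite (ieval_var HU).
  + apply: ECall (ESucc (EVar _ _ _)) _.
    have ltw := outer_nonblank_succ out ltx nb.
    apply: (StarS_complete _ (IH _)) => //.
    - by rewrite (ieval_succ_var HU) succ_ix_rank.
    - exact: succ_ix_lt.
    by rewrite (ieval_succ_var HU) succ_ix_rank.
  apply: ECall (EPred (EVar _ _ _)) _.
  have gt0 := outer_nonblank_pred out ltx nb.
  apply: (StarP_complete (IH _)) => //; first exact: pred_ix_lt.
  by rewrite (ieval_pred_var HU) pred_ix_rank // prednK.
- move=> k c [] //= v HU _ x ltx nb rx.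
  rewrite (ieval_var HU) -rx carries_rank //.
  by apply: EChar; apply: EVar.
- move=> k [] //= v HU _ x ltx nb rx.
  by rewrite (ieval_var HU) -rx; exact: beval_maxc.
- move=> k [] //= v HU _ x ltx nb rx.
  by rewrite (ieval_var HU) -rx; exact: beval_minc.
- move=> k B T U b _ IHB _ IHT /= /and3P[nB nT nU] x ltx nb rx.
  by apply: EBIteT; [apply: IHB | apply: IHT].
move=> k B T U b _ IHB _ IHU /= /and3P[nB nT nU] x ltx nb rx.
by apply: EBIteF; [apply: IHB | apply: IHU].
Qed.

End Enrichment.

(** * Equality of outputs and inherited strictness *)

Theorem theorem3 (Sigma Gamma : finType) (m : nat) (e : blank_extrema Gamma)
    (pi : interpretation (option Sigma) Gamma m)
    (pi_wd : well_defined pi) (pi_strict : strict pi)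
    (pi_nf : normal_form pi) (s : seq (option Gamma)) :
  (forall t u : seq (option Sigma),
     denotes (blank_enrichment e pi) s t -> denotes pi (del_blanks s) u ->
     del_blanks t = del_blanks u) /\
  (outer_nonblank s ->
     well_defined_on (blank_enrichment e pi) s /\
     strict_on (blank_enrichment e pi) s).
Proof.
case: pi_nf => nf_body nf_head.
have blank_head x sigma i b : carries s x None ->
    head_eval (blank_enrichment e pi) s x sigma i b <-> b = (sigma == None).
  move=> bl; rewrite /head_eval; split=> [/beval_if_blank | ->].
    by rewrite bl; case: sigma => [a|] H; inversion H.
  apply/beval_if_blank; rewrite bl.
  by case: sigma => [a|]; [exact: EFalse | exact: ETrue].
have sound x sigma i b : x < size s -> ~~ carries s x None ->
    head_eval (blank_enrichment e pi) s x sigma i b ->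
    head_eval pi (del_blanks s) (rank s x) sigma i b.
  move=> ltx nb /beval_if_blank; rewrite (negPf nb).
  exact: star_sound.
split.
  move=> t u [szt Ht] [szu Hu]; apply: (del_blanks_blocks szt szu).
  move=> k r ltk ltr; have lt_t : m * k + r < size t.
    rewrite szt (leq_trans (n := m * k.+1)) ?leq_mul2l ?ltk ?orbT //.
    by rewrite mulnS addnC ltn_add2r.
  (* The symbol of [t] at this place is one whose enriched head is true; at a non-blank [k],
     soundness passes it to [pi], and [Hu] then locates it in [u]. *)
  have Ek : head_eval (blank_enrichment e pi) s k (nth None t (m * k + r))
      (Ordinal ltr) true.
    by apply/Ht => //=; rewrite carries_nth.
  case: ifPn => [bl | nb].
    by move/(blank_head _ _ _ _ bl): Ek => /esym/eqP.
  have /(Hu _ (Ordinal ltr) _ (rank_lt ltk nb)) /= := sound _ _ _ _ ltk nb Ek.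
  by move=> /eqP/(onth_nth None) ->.
move=> out.
have complete x sigma i b : x < size s -> ~~ carries s x None ->
    head_eval pi (del_blanks s) (rank s x) sigma i b ->
    head_eval (blank_enrichment e pi) s x sigma i b.
  move=> ltx nb H; apply/beval_if_blank; rewrite (negPf nb).
  exact: star_complete H out _ _ _ _ _.
split=> i x ltx; case: (boolP (carries s x None)) => [bl | nb].
- split=> [sigma tau | sigma].
    by move=> /(blank_head _ _ _ _ bl)/esym/eqP-> /(blank_head _ _ _ _ bl)/esym/eqP->.
  case E: (sigma == None); [left | right]; exact/(blank_head _ _ _ _ bl).
(* Uniqueness transfers through soundness, totality through completeness. *)
- have [uniq_true total] := pi_wd _ i _ (rank_lt ltx nb); split=> [sigma tau | sigma].
    by move=> /(sound _ _ _ _ ltx nb) ? /(sound _ _ _ _ ltx nb); exact: uniq_true.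
  by case: (total sigma) => /(complete _ _ _ _ ltx nb); [left | right].
- exists None; split=> [|sigma]; first exact/(blank_head _ _ _ _ bl).
  by move=> /(blank_head _ _ _ _ bl)/esym/eqP->.
have [sigma [H U]] := pi_strict _ i _ (rank_lt ltx nb).
exists sigma; split=> [|tau]; first exact: complete.
by move=> /(sound _ _ _ _ ltx nb)/U.
Qed.
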